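(* Let $A$ be a nonzero $C^*$-algebra (possibly nonunital), and let $b\in A$ be an approximately right invertible element. Then $b$ is an isolated point of the orthograph $\Gamma(A)$.
   Context: Let $A$ be a $C^*$-algebra. An element $a\in A$ is approximately right invertible if there is a net $\{b_i\}_{i\in I}$ in $A$ such that $\{ab_i\}_{i\in I}$ is an approximate unit for $A$. For $a,b\in A$, $a$ is strong $BJ$-orthogonal to $b$, written $a\perp^S b$, if $\|a+bc\|\ge\|a\|$ for every $c\in A$. The elements $a,b$ are mutually strong $BJ$-orthogonal, written $a\mathrel{\perp\!\!\!\!\perp}^S b$, if $a\perp^S b$ and $b\perp^S a$. These relations do not change when $a$, $b$ are replaced by nonzero scalar multiples. The orthograph $\Gamma(A)$ is the graph whose vertex set is the projective space $S=(A\setminus\{0\})/(a\sim\lambda a,\ \lambda\in\mathbb C\setminus\{0\})$ and whose edges are the pairs $(a,b)\in S\times S$ with $a\mathrel{\perp\!\!\!\!\perp}^S b$. A nonzero element is identified with the vertex it represents. An isolated point (isolated vertex) is a vertex belonging to no edge. *)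

(* Defs.v *)
From HB Require Import structures.
From mathcomp Require Import all_boot all_order all_algebra generic_quotient.
From mathcomp Require Import complex.
From mathcomp Require Import all_classical all_reals all_analysis.
Set Implicit Arguments.
Unset Strict Implicit.
Unset Printing Implicit Defensive.
Import Order.TTheory GRing.Theory Num.Theory.
Import numFieldNormedType.Exports.

Local Open Scope classical_set_scope.
Local Open Scope complex_scope.
Local Open Scope quotient_scope.
Local Open Scope ring_scope.

(* The multiplication is a separate operation because the library's rings are
   unital, whereas a C*-algebra need not be.  The norm takes its values in the
   scalar field R[i]; for the order of R[i], [x <= y] implies that [y - x] is
   real. *)
HB.mixin Record isCstarAlgebra (R : realType) A
    & CompleteNormedModule R[i] A := {
  cmul : A -> A -> A;
  star : A -> A;
  cmulA : associative cmul;
  cmulDl : left_distributive cmul +%R;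
  cmulDr : right_distributive cmul +%R;
  cscaleAl : forall (k : R[i]) (x y : A), k *: cmul x y = cmul (k *: x) y;
  cscaleAr : forall (k : R[i]) (x y : A), k *: cmul x y = cmul x (k *: y);
  norm_cmul : forall x y : A, `|cmul x y| <= `|x| * `|y|;
  starK : involutive star;
  starD : {morph star : x y / x + y};
  starZ : forall (k : R[i]) (x : A), star (k *: x) = Num.conj k *: star x;
  starM : forall x y : A, star (cmul x y) = cmul (star y) (star x);
  norm_star_cmul : forall x : A, `|cmul (star x) x| = `|x| ^+ 2
}.

#[short(type="cstarAlgType")]
HB.structure Definition CstarAlgebra (R : realType) :=
  { A of isCstarAlgebra R A & CompleteNormedModule R[i] A }.

Notation "x ⋅ y" := (cmul x y) (at level 40, left associativity) : ring_scope.

Definition directed_preorder (I : Type) (le : I -> I -> Prop) : Prop :=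
  [/\ inhabited I,
      forall i, le i i,
      forall i j k, le i j -> le j k -> le i k &
      forall i j, exists k, le i k /\ le j k].

Definition net_tails (I : Type) (le : I -> I -> Prop) : set_system I :=
  filter_from setT (fun i => [set j | le i j]).

Section CstarDefs.
Variables (R : realType) (A : cstarAlgType R).
Implicit Types a b c x : A.

(* Neither boundedness, positivity nor monotonicity of the net is required. *)
Definition approximate_unit (I : Type) (le : I -> I -> Prop) (e : I -> A) :=
  forall x, (e i ⋅ x @[i --> net_tails le] --> x) /\
            (x ⋅ e i @[i --> net_tails le] --> x).

Definition approximately_right_invertible a : Prop :=
  exists (I : Type) (le : I -> I -> Prop) (b : I -> A),
    directed_preorder le /\ approximate_unit le (fun i => a ⋅ b i).

Definition strong_BJ a b : Prop := forall c, `|a| <= `|a + b ⋅ c|.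

Definition mutual_strong_BJ a b : Prop := strong_BJ a b /\ strong_BJ b a.

Definition nonzero_elt : Type := {a : A | a != 0}.

HB.instance Definition _ := Choice.on nonzero_elt.

Definition collinear (u v : nonzero_elt) : bool :=
  `[< exists k : R[i], k != 0 /\ val v = k *: val u >].

Lemma collinear_refl : reflexive collinear.
Proof. by move=> u; apply/asboolP; exists 1; rewrite oner_neq0 scale1r. Qed.

Lemma collinear_sym : symmetric collinear.
Proof.
suff H u v : collinear u v -> collinear v u.
  by move=> u v; apply/idP/idP; exact: H.
move=> /asboolP[k [k0 vE]]; apply/asboolP; exists k^-1.
by rewrite invr_neq0// vE scalerA mulVf// scale1r.
Qed.

Lemma collinear_trans : transitive collinear.
Proof.
move=> v u w /asboolP[k [k0 vE]] /asboolP[l [l0 wE]].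
by apply/asboolP; exists (l * k); rewrite mulf_neq0// wE vE scalerA.
Qed.

Canonical collinear_equiv :=
  EquivRel collinear collinear_refl collinear_sym collinear_trans.

Definition proj_space := {eq_quot collinear_equiv}.

Definition proj_class (u : nonzero_elt) : proj_space := \pi_proj_space u.

Definition ortho_edge (p q : proj_space) : Prop :=
  exists u v : nonzero_elt,
    [/\ proj_class u = p, proj_class v = q & mutual_strong_BJ (val u) (val v)].

End CstarDefs.

Record graph := Graph { vertex : Type; edge : vertex -> vertex -> Prop }.

Definition isolated_vertex (G : graph) (p : vertex G) : Prop :=
  forall q r : vertex G, edge q r -> p <> q /\ p <> r.

Definition orthograph (R : realType) (A : cstarAlgType R) : graph :=
  Graph (@ortho_edge R A).

Definition orthograph_vertex (R : realType) (A : cstarAlgType R) (a : A)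
    (a0 : a != 0) : vertex (orthograph A) :=
  proj_class (exist _ a a0).

(* Main.v *)
Require Import Defs.
From mathcomp Require Import all_boot all_order all_algebra.
From mathcomp Require Import reals.
From mathcomp Require Import generic_quotient complex all_classical all_analysis.

Import Order.TTheory GRing.Theory Num.Theory.
Import numFieldNormedType.Exports.

Local Open Scope ring_scope.

(** If [a ⋅ b_i] is an approximate unit, then [c - a ⋅ (b_i ⋅ c)] tends to [0]
    for every [c], so [c] can be [strong_BJ]-orthogonal to [a] only when
    [c = 0] ([strong_BJ_approximately_right_invertible]).  One direction of
    mutual orthogonality therefore already excludes every edge at [a], once
    orthogonality is known not to depend on the representative of the line
    through [a] ([strong_BJ_collinear]).  The same lemma gives [a != 0] in a
    nonzero algebra, because everything is orthogonal to [0]. *)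

Section StrongBJ.
Context {R : realType} {A : cstarAlgType R}.
Implicit Types a b c : A.

Lemma cmul0l c : (0 : A) ⋅ c = 0.
Proof. by apply: (addrI (0 ⋅ c)); rewrite -cmulDl !addr0. Qed.

Lemma cmulNr a c : a ⋅ (- c) = - (a ⋅ c).
Proof. by rewrite -scaleN1r -cscaleAr scaleN1r. Qed.

Lemma strong_BJ0 a : strong_BJ a 0.
Proof. by move=> c; rewrite cmul0l addr0. Qed.

(** The scalar relating two representatives is absorbed by the right
    multiplier over which [strong_BJ] quantifies. *)
Lemma strong_BJ_collinear c (u v : nonzero_elt A) :
  collinear u v -> strong_BJ c (val v) -> strong_BJ c (val u).
Proof.
move=> /asboolP[k [k0 vE]] cv d.
have := cv (k^-1 *: d).
by rewrite vE -cscaleAr cscaleAl scalerA mulVf// scale1r.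
Qed.

(** Testing orthogonality against [- (b_i ⋅ c)] bounds [`|c|] by the distance
    from [c] to [a ⋅ b_i ⋅ c], which is smaller than any positive number for
    some [i]; the number chosen is [`|c|] itself. *)
Lemma strong_BJ_approximately_right_invertible a c :
  approximately_right_invertible a -> strong_BJ c a -> c = 0.
Proof.
move=> [I [le [b [[_ le_refl _ _] ab_unit]]]] ca.
apply/eqP/negPn/negP => c0.
have c_gt0 : 0 < `|c| by rewrite normr_gt0.
have [abc_c _] := ab_unit c.
have [i _ close_i] := abc_c _ (nbhsx_ballx c _ c_gt0).
have := close_i i (le_refl i); rewrite /= -ball_normE /= => lt_c.
have := ca (- (b i ⋅ c)).
by rewrite cmulNr cmulA => /le_lt_trans/(_ lt_c); rewrite ltxx.
Qed.

End StrongBJ.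

Theorem proposition2p5 (R : realType) (A : cstarAlgType R)
    (A_nonzero : exists x : A, x != 0)
    (b : A) (b_ari : approximately_right_invertible b) :
  exists b0 : b != 0, isolated_vertex (orthograph_vertex b0).
Proof.
have b0 : b != 0.
  apply/eqP => bE; have [x /eqP x0] := A_nonzero; apply: x0.
  apply: (strong_BJ_approximately_right_invertible _ _ b_ari).
  by rewrite bE; exact: strong_BJ0.
exists b0.
have not_orthogonal (u v : nonzero_elt A) :
    proj_class v = orthograph_vertex b0 -> ~ strong_BJ (val u) (val v).
  move=> /esym/eqmodP bv uv; have /eqP := valP u; apply.
  apply: (strong_BJ_approximately_right_invertible _ _ b_ari).
  exact: (strong_BJ_collinear _ (exist _ b b0) v bv).
move=> q r [u [v [uq vr [uv vu]]]]; split => [bq|br].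
- by apply: (not_orthogonal v u) => //; rewrite uq.
- by apply: (not_orthogonal u v) => //; rewrite vr.
Qed.
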